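(* There exists a finite valued inertial extension $(F|L,v)$ such that the valuation ring $\mathcal O_F$ is not a finitely generated $\mathcal O_L$-algebra.
   Context: A valued field extension $(F|L,v)$ is a field extension $F|L$ together with a (Krull) valuation $v$ on $F$ (arbitrary value group); its restriction to $L$ is again denoted $v$. $\mathcal O_F$ is the valuation ring of $v$ on $F$ and $\mathcal O_L=\mathcal O_F\cap L$. Given a valued field $(L,v)$ and an extension of $v$ to the separable-algebraic closure $L^{\mathrm{sep}}$ (again denoted $v$, with maximal ideal $\mathfrak m_v$), let $I(\mathcal O_L)$ be the integral closure of $\mathcal O_L$ in $L^{\mathrm{sep}}$; the absolute inertia field $L^i$ is the subfield of $L^{\mathrm{sep}}$ of elements fixed by $\{\sigma\in\mathrm{Gal}(L^{\mathrm{sep}}|L)\mid \forall x\in I(\mathcal O_L):\ x-\sigma(x)\in\mathfrak m_v\cap I(\mathcal O_L)\}$. A finite valued inertial extension is a valued field extension $(F|L,v)$ with $[F:L]<\infty$ and $F\subseteq L^i$, where $L^i$ is taken with respect to an extension to $L^{\mathrm{sep}}$ of the valuation $v$ of $F$. *)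

(* Defs.v *)
From HB Require Import structures.
From mathcomp Require Import all_boot all_order all_algebra all_field.
From mathcomp Require Import mpoly.

Set Implicit Arguments.
Unset Strict Implicit.
Unset Printing Implicit Defensive.

Import Order.TTheory GRing.Theory.

Local Open Scope ring_scope.

(* Totally ordered abelian groups, of arbitrary rank: porderZmodType does not
   relate the order to the group law. *)
HB.mixin Record isOrderedAbelianGroup G of Num.POrderedZmodule G := {
  oag_total : forall x y : G, (x <= y) || (y <= x);
  oag_leD2r : forall z x y : G, x <= y -> x + z <= y + z
}.

#[short(type="orderedAbelianGroupType")]
HB.structure Definition OrderedAbelianGroup :=
  { G of isOrderedAbelianGroup G & Num.POrderedZmodule G }.

(* [option G] stands for G with a largest element infinity, encoded by [None]. *)
Section Infinity.
Context {G : orderedAbelianGroupType}.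
Implicit Types a b : option G.

Definition vle a b : bool :=
  match a, b with
  | _, None => true
  | None, Some _ => false
  | Some x, Some y => x <= y
  end.

Definition vlt a b : bool := ~~ vle b a.

Definition vmin a b : option G := if vle a b then a else b.

Definition vadd a b : option G :=
  match a, b with
  | Some x, Some y => Some (x + y)
  | _, _ => None
  end.

End Infinity.

(* Krull valuations, written additively. [G] is only required to contain the
   value group: v need not be surjective. *)
Record valuation (F : fieldType) (G : orderedAbelianGroupType) := Valuation {
  valuation_fun :> F -> option G;
  valuation_eq0 : forall x, valuation_fun x = None <-> x = 0;
  valuationM : forall x y,
    valuation_fun (x * y) = vadd (valuation_fun x) (valuation_fun y);
  valuationD : forall x y,
    vle (vmin (valuation_fun x) (valuation_fun y)) (valuation_fun (x + y))
}.

Section Restriction.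
Variables (L F : fieldType) (G : orderedAbelianGroupType).
Variables (f : {rmorphism L -> F}) (v : valuation F G).

Fact restriction_eq0 (x : L) : v (f x) = None <-> x = 0.
Proof.
rewrite valuation_eq0; split=> [/eqP|->]; last exact: rmorph0.
by rewrite fmorph_eq0 => /eqP.
Qed.

Fact restrictionM (x y : L) : v (f (x * y)) = vadd (v (f x)) (v (f y)).
Proof. by rewrite rmorphM valuationM. Qed.

Fact restrictionD (x y : L) :
  vle (vmin (v (f x)) (v (f y))) (v (f (x + y))).
Proof. by rewrite rmorphD valuationD. Qed.

Definition restriction : valuation L G :=
  Valuation restriction_eq0 restrictionM restrictionD.

End Restriction.

Section ValuationRing.
Variables (F : fieldType) (G : orderedAbelianGroupType) (v : valuation F G).

Definition valuation_integer : qualifier 1 F :=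
  [qualify a x : F | vle (Some 0) (v x)].

Fact oag_double0 (x : G) : x + x = 0 -> x = 0.
Proof.
move=> xx0; apply/le_anti/andP.
by case/orP: (oag_total x 0) => xle; split=> //;
  have := oag_leD2r x _ _ xle; rewrite xx0 add0r.
Qed.

Fact valuation1 : v 1 = Some 0.
Proof.
have := valuationM v 1 1; rewrite mulr1.
case v1: (v 1) => [g|]; last first.
  by move/valuation_eq0/eqP: v1; rewrite oner_eq0.
by case=> /eqP; rewrite -subr_eq0 opprD addNKr oppr_eq0 => /eqP ->.
Qed.

Fact valuationN1 : v (-1) = Some 0.
Proof.
have := valuationM v (-1) (-1); rewrite mulrNN mulr1 valuation1.
by case: (v (-1)) => //= g [] /esym/oag_double0 ->.
Qed.

Fact valuation_integer_subring_closed : subring_closed valuation_integer.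
Proof.
have M : {in valuation_integer &, forall x y, x * y \is a valuation_integer}.
  move=> x y; rewrite !qualifE /= valuationM.
  case: (v x) => [g|] //; case: (v y) => [h|] //= g0 h0.
  by apply: le_trans h0 _; have := oag_leD2r h _ _ g0; rewrite add0r.
have N1 : -1 \is a valuation_integer by rewrite qualifE /= valuationN1 /=.
split=> //; first by rewrite qualifE /= valuation1 /=.
move=> x y xO yO.
have {yO} : - y \is a valuation_integer by rewrite -mulN1r M.
move: xO; rewrite !qualifE; have := valuationD v x (- y); rewrite /vmin.
by case: ifP => _; case: (v (x - y)) => [k|] //;
  case: (v x) => [g|] //; case: (v (- y)) => [h|] //=;
  move=> le1 le2 le3; apply: le_trans le1.
Qed.

HB.instance Definition _ :=
  GRing.isSubringClosed.Build F (has_quality 1 valuation_integer)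
    valuation_integer_subring_closed.

Record valuation_ring := ValuationRing {
  valuation_ring_val : F;
  _ : valuation_ring_val \is a valuation_integer
}.

HB.instance Definition _ := [isSub for valuation_ring_val].
HB.instance Definition _ := [Choice of valuation_ring by <:].
HB.instance Definition _ :=
  [SubChoice_isSubComNzRing of valuation_ring by <:].

Definition maximal_ideal : pred F := [pred x | vlt (Some 0) (v x)].

End ValuationRing.

(* The inclusion of O_L in O_F, where O_L is the preimage of O_F under
   f : L -> F, i.e. the valuation ring of the restriction of v. *)
Section ValuationRingInclusion.
Variables (L F : fieldType) (G : orderedAbelianGroupType).
Variables (f : {rmorphism L -> F}) (v : valuation F G).

Definition valuation_ring_incl (x : valuation_ring (restriction f v)) :
  valuation_ring v := @ValuationRing F G v (f (val x)) (valP x).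

Fact valuation_ring_incl_zmod_morphism : zmod_morphism valuation_ring_incl.
Proof. by move=> x y; apply: val_inj; rewrite /= !rmorphB. Qed.

Fact valuation_ring_incl_monoid_morphism : monoid_morphism valuation_ring_incl.
Proof.
by split=> [|x y]; apply: val_inj; rewrite /= ?rmorph1 ?rmorphM.
Qed.

HB.instance Definition _ := GRing.isZmodMorphism.Build _ _ valuation_ring_incl
  valuation_ring_incl_zmod_morphism.
HB.instance Definition _ := GRing.isMonoidMorphism.Build _ _ valuation_ring_incl
  valuation_ring_incl_monoid_morphism.

End ValuationRingInclusion.

Arguments valuation_ring_incl {L F G} f v x.

(* A is a quotient of a polynomial ring R[X_0, ..., X_(n-1)]. *)
Definition finitely_generated_algebra (R A : comNzRingType)
    (f : {rmorphism R -> A}) : Prop :=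
  exists (n : nat) (s : 'I_n -> A),
    forall a : A, exists p : {mpoly R[n]}, mmap f s p = a.

Section SeparableClosure.
Variables (L K : fieldType) (f : {rmorphism L -> K}).

(* The irreducible polynomial p is the minimal polynomial of x up to a
   nonzero constant. *)
Definition separable_algebraic_over (x : K) : Prop :=
  exists p : {poly L},
    [/\ irreducible_poly p, separable_poly p & root (map_poly f p) x].

Definition separably_closed : Prop :=
  forall p : {poly K}, (1 < size p)%N -> separable_poly p -> exists x, root p x.

Definition separable_closure : Prop :=
  (forall x, separable_algebraic_over x) /\ separably_closed.

(* s belongs to Gal(K|L). *)
Definition is_automorphism_over (s : {rmorphism K -> K}) : Prop :=
  bijective s /\ forall a : L, s (f a) = f a.

End SeparableClosure.

(* Below f : L -> Lsep is meant to be a separable closure of L, and w a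
   valuation of Lsep. *)
Section Inertia.
Variables (L Lsep : fieldType) (G : orderedAbelianGroupType).
Variables (f : {rmorphism L -> Lsep}) (w : valuation Lsep G).

(* The integral closure I(O_L) of O_L in Lsep. *)
Definition integral_closure (x : Lsep) : Prop :=
  integralOver (f \o @valuation_ring_val L G (restriction f w)) x.

Definition absolute_inertia_group (s : {rmorphism Lsep -> Lsep}) : Prop :=
  is_automorphism_over f s /\
  forall x, integral_closure x ->
    x - s x \in maximal_ideal w /\ integral_closure (x - s x).

Definition absolute_inertia_field (x : Lsep) : Prop :=
  forall s : {rmorphism Lsep -> Lsep}, absolute_inertia_group s -> s x = x.

End Inertia.

(* w extends v along j, the ordered group of v being embedded in that of w. *)
Definition valuation_extension (F K : fieldType)
    (G H : orderedAbelianGroupType) (j : {rmorphism F -> K})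
    (v : valuation F G) (w : valuation K H) : Prop :=
  exists phi : {additive G -> H},
    {mono phi : x y / x <= y} /\ forall x, w (j x) = omap phi (v x).

(* F : fieldExtType L already makes [F : L] finite; L is embedded in F by
   in_alg F. *)
Definition inertial_extension (L : fieldType) (F : fieldExtType L)
    (G : orderedAbelianGroupType) (v : valuation F G) : Prop :=
  exists (Lsep : fieldType) (j : {rmorphism F -> Lsep})
         (H : orderedAbelianGroupType) (w : valuation Lsep H),
    let f : {rmorphism L -> Lsep} := j \o in_alg F in
    [/\ separable_closure f, valuation_extension j v w
      & forall x : F, absolute_inertia_field f w (j x)].

(* Main.v *)
(* L is a field of nonstandard rationals, F = L(sqrt 2), and v measures the
   size of elements of an ultrapower K of the complex numbers: O_F consists of
   the bounded elements. Since L lies in the ultrapower of Q, sqrt 2 is not in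
   L. As 2 sqrt 2 is a unit, no element of the inertia group can send sqrt 2 to
   - sqrt 2, so F | L is inertial.

   Let s_0 < s_1 < s_2 < ... be infinite integers in K such that s_(n+1) exceeds
   every finite power of s_n, and let L be the field of the fractions p / q with
   |p|, |q| <= s_n for some n. The ring T_n of elements of K bounded by a finite
   power of s_n contains O_L. If O_F were generated over O_L by finitely many
   elements, their conjugates would lie in a common T_n, so all of O_F would
   have its conjugate in T_n. However, L contains approximations z of sqrt 2
   with |z - sqrt 2| <= 1 / s_(n+1); then 1 / (z + sqrt 2) is in O_F while its
   conjugate 1 / (z - sqrt 2) is not in T_n. *)

Require Import Defs.
From HB Require Import structures.
From mathcomp Require Import all_boot all_order all_algebra all_field.
From mathcomp Require Import boolp classical_sets functions filter.
From mathcomp Require mpoly.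

Set Implicit Arguments.
Unset Strict Implicit.
Unset Printing Implicit Defensive.

Import Order.TTheory GRing.Theory Num.Theory.

Local Open Scope classical_set_scope.
Local Open Scope ring_scope.

(** * The valuation of a valuation ring *)

Record valuation_subring (K : fieldType) := ValuationSubring {
  valuation_subring_pred :> {pred K};
  valuation_subring_closed : subring_closed valuation_subring_pred;
  valuation_subring_total : forall x : K,
    x \in valuation_subring_pred \/ x^-1 \in valuation_subring_pred
}.

Section ValueGroup.
Variables (K : fieldType) (O : valuation_subring K).

Let O1 : 1 \in O.
Proof. by case: (valuation_subring_closed O). Qed.

Let OB : {in O &, forall x y, x - y \in O}.
Proof. by case: (valuation_subring_closed O). Qed.

Let OM : {in O &, forall x y, x * y \in O}.
Proof. by case: (valuation_subring_closed O). Qed.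

Let OD : {in O &, forall x y, x + y \in O}.
Proof.
move=> x y xO yO; rewrite -[y]opprK OB // -sub0r OB //.
by rewrite -(subrr 1) OB.
Qed.

Definition nonzero := {x : K | x != 0}.

Definition nonzero_dvd (x y : nonzero) := val y / val x \in O.

Let dvd_refl x : nonzero_dvd x x.
Proof. by rewrite /nonzero_dvd divff ?O1 ?(valP x). Qed.

Let dvd_trans y x z : nonzero_dvd x y -> nonzero_dvd y z -> nonzero_dvd x z.
Proof.
rewrite /nonzero_dvd => xy /OM/(_ xy).
by rewrite mulrA divfK ?(valP y).
Qed.

Let dvd_total x y : nonzero_dvd x y || nonzero_dvd y x.
Proof.
apply/orP; rewrite /nonzero_dvd -[val x / val y]invf_div.
exact: valuation_subring_total.
Qed.

Definition nonzero_assoc (x y : nonzero) := nonzero_dvd x y && nonzero_dvd y x.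

Fact nonzero_assoc_equiv : equiv_class_of nonzero_assoc.
Proof.
split=> [x|x y|y x z]; first by rewrite /nonzero_assoc dvd_refl.
  by rewrite /nonzero_assoc andbC.
case/andP=> xy yx /andP[yz zy].
by rewrite /nonzero_assoc (dvd_trans xy yz) (dvd_trans zy yx).
Qed.

Canonical nonzero_assoc_equivr := EquivRelPack nonzero_assoc_equiv.

(** The quotient of K^* by the units of O. Written additively and ordered by divisibility, it is the
    value group of O. *)
Definition value_group := {eq_quot nonzero_assoc}%qT.
HB.instance Definition _ : EqQuotient nonzero nonzero_assoc value_group :=
  EqQuotient.on value_group.
HB.instance Definition _ := Choice.on value_group.

Implicit Types (x y z : nonzero) (a b c : value_group).

Let nz1 : nonzero := Sub 1 (oner_neq0 K).
Let nzM x y : nonzero := Sub (val x * val y) (mulf_neq0 (valP x) (valP y)).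
Let nzV x : nonzero := Sub (val x)^-1 (invr_neq0 (valP x)).

Let cl x : value_group := (\pi x)%qT.

Let clE x y : cl x = cl y <-> nonzero_assoc x y.
Proof. by split=> [/eqmodP|/eqmodP]. Qed.

(** Sum, opposite and order are read on chosen representatives; [addE], [oppE] and [leE] show that
    the choice is immaterial. *)
Definition value_add a b := cl (nzM (repr a) (repr b)).
Definition value_opp a := cl (nzV (repr a)).
Definition value_le a b := nonzero_dvd (repr a) (repr b).

Let reprP x : nonzero_assoc (repr (cl x)) x.
Proof. by apply/clE; rewrite /cl reprK. Qed.

Let dvdM x y z t : nonzero_dvd x z -> nonzero_dvd y t ->
  nonzero_dvd (nzM x y) (nzM z t).
Proof. by rewrite /nonzero_dvd => xz yt; rewrite /= -mulf_div OM. Qed.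

Let addE x y : value_add (cl x) (cl y) = cl (nzM x y).
Proof.
apply/clE; have /andP[? ?] := reprP x; have /andP[? ?] := reprP y.
by rewrite /nonzero_assoc !dvdM.
Qed.

Let oppE x : value_opp (cl x) = cl (nzV x).
Proof.
apply/clE; have /andP[d1 d2] := reprP x.
by rewrite /nonzero_assoc /nonzero_dvd /= !invrK ![_^-1 * _]mulrC; apply/andP.
Qed.

Let leE x y : value_le (cl x) (cl y) = nonzero_dvd x y.
Proof.
have /andP[d1 d2] := reprP x; have /andP[d3 d4] := reprP y.
apply/idP/idP => h; first exact: dvd_trans d2 (dvd_trans h d3).
exact: dvd_trans d1 (dvd_trans h d4).
Qed.

Let cl_surj a : exists x, a = cl x.
Proof. by exists (repr a); rewrite /cl reprK. Qed.

Fact value_addA : associative value_add.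
Proof.
move=> a b c; case: (cl_surj a) (cl_surj b) (cl_surj c) => x -> [y ->] [z ->].
by rewrite !addE; congr cl; apply: val_inj; rewrite /= mulrA.
Qed.

Fact value_addC : commutative value_add.
Proof.
move=> a b; case: (cl_surj a) (cl_surj b) => x -> [y ->].
by rewrite !addE; congr cl; apply: val_inj; rewrite /= mulrC.
Qed.

Fact value_add0 : left_id (cl nz1) value_add.
Proof.
move=> a; case: (cl_surj a) => x ->.
by rewrite !addE; congr cl; apply: val_inj; rewrite /= mul1r.
Qed.

Fact value_addN : left_inverse (cl nz1) value_opp value_add.
Proof.
move=> a; case: (cl_surj a) => x ->.
by rewrite oppE addE; congr cl; apply: val_inj; rewrite /= mulVf ?(valP x).
Qed.

HB.instance Definition _ :=
  GRing.isZmodule.Build value_group value_addA value_addC value_add0 value_addN.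

Fact value_le_refl : reflexive value_le.
Proof. by move=> a; apply: dvd_refl. Qed.

Fact value_le_anti : antisymmetric value_le.
Proof.
move=> a b; case: (cl_surj a) (cl_surj b) => x -> [y ->].
by rewrite !leE => ?; apply/clE.
Qed.

Fact value_le_trans : transitive value_le.
Proof. by move=> b a c; apply: dvd_trans. Qed.

HB.instance Definition _ := Order.Le_isPOrder.Build ring_display value_group
  value_le_refl value_le_anti value_le_trans.

Fact value_le_total a b : (a <= b) || (b <= a).
Proof. exact: dvd_total. Qed.

Fact value_leD2r c a b : a <= b -> a + c <= b + c.
Proof.
case: (cl_surj a) (cl_surj b) (cl_surj c) => x -> [y ->] [z ->].
rewrite [_ <= _]leE => xy; rewrite [_ + _]addE [X in _ <= X]addE.
by rewrite [_ <= _]leE; apply: dvdM.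
Qed.

HB.instance Definition _ :=
  isOrderedAbelianGroup.Build value_group value_le_total value_leD2r.

(** [insub x] fails exactly at x = 0, which thus gets the value infinity. *)
Definition subring_value (x : K) : option value_group := omap cl (insub x).

Let subring_valueE x : subring_value (val x) = Some (cl x).
Proof. by rewrite /subring_value valK. Qed.

Let value0 : subring_value 0 = None.
Proof. by rewrite /subring_value insubF ?eqxx. Qed.

Fact subring_value_eq0 (x : K) : subring_value x = None <-> x = 0.
Proof.
split=> [|->]; last exact: value0.
by rewrite /subring_value; case: insubP => // /negPn/eqP.
Qed.

Let valueP (x : K) : x = 0 \/ exists y : nonzero, x = val y.
Proof. by have [->|x0] := eqVneq x 0; [left | right; exists (Sub x x0)]. Qed.

Fact subring_valueM (x y : K) :
  subring_value (x * y) = vadd (subring_value x) (subring_value y).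
Proof.
have [->|[x' ->]] := valueP x; first by rewrite mul0r value0.
have [->|[y' ->]] := valueP y.
  by rewrite mulr0 value0; case: subring_value.
rewrite -[_ * _]/(val (nzM x' y')) !subring_valueE /=.
by congr Some; rewrite -addE.
Qed.

Fact subring_valueD (x y : K) :
  vle (vmin (subring_value x) (subring_value y)) (subring_value (x + y)).
Proof.
have [->|[x' ->]] := valueP x.
  rewrite value0 add0r /vmin.
  by case: (subring_value y) => //= g; apply: lexx.
have [->|[y' ->]] := valueP y.
  rewrite value0 addr0 /vmin.
  by case: (subring_value _) => //= g; apply: lexx.
have [->|[z e]] := valueP (val x' + val y').
  by rewrite value0; case: vmin.
rewrite e !subring_valueE /vmin /= [cl x' <= _]leE.
(* Divided by the term of smaller value, the sum becomes 1 plus an element of O. *)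
case: ifPn => /= [xy|nxy]; rewrite [_ <= _]leE /nonzero_dvd -e mulrDl OD //.
- by rewrite divff ?(valP x') ?O1.
- by have := dvd_total x' y'; rewrite (negPf nxy).
- by rewrite divff ?(valP y') ?O1.
Qed.

Definition subring_valuation : valuation K value_group :=
  Valuation subring_value_eq0 subring_valueM subring_valueD.

Lemma subring_valuation_integer (x : K) :
  (x \is a valuation_integer subring_valuation) = (x \in O).
Proof.
rewrite qualifE /=.
have [->|[y ->]] := valueP x; first by rewrite value0 -(subrr 1) OB.
rewrite subring_valueE /=; apply: etrans (leE nz1 y) _.
by rewrite /nonzero_dvd /= divr1.
Qed.

End ValueGroup.

(** * Ultrapowers *)

Section Ultrapower.
Variables (T : pointedType) (C : fieldType) (U : set_system T).
Hypothesis UU : UltraFilter U.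
Implicit Types f g : T -> C.

Definition ultra_null f : bool := `[< U [set k | f k = 0] >].

Fact ultra_null_idealr : idealr_closed ultra_null.
Proof.
split=> [||a f g].
- by apply/asboolP; apply: filterE.
- apply/asboolP => /(@filter_ex _ _ _)[k] /eqP; rewrite oner_eq0 //.
- move=> /asboolP f0 /asboolP g0; apply/asboolP; apply: filterS2 f0 g0 => k.
  by move=> /= f0 g0; rewrite /GRing.add/= /GRing.mul/= f0 g0 mulr0 addr0.
Qed.

HB.instance Definition _ :=
  isIdealr.Build (T -> C) ultra_null ultra_null_idealr.

Definition ultra_ideal : idealr (T -> C) := Idealr.clone _ ultra_null _.

Definition ultrapower := {ideal_quot ultra_ideal}.
HB.instance Definition _ := GRing.ComNzRing.on ultrapower.

Definition ultra_class : (T -> C) -> ultrapower := \pi%qT.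

HB.instance Definition _ :=
  GRing.RMorphism.copy ultra_class (\pi_ultrapower)%qT.

Lemma ultra_class_eq f g :
  ultra_class f = ultra_class g <-> U [set k | f k = g k].
Proof.
split=> [/eqmodP|fg].
  rewrite /= Quotient.equivE => /asboolP; apply: filterS => k /=.
  by move/eqP; rewrite subr_eq0 => /eqP.
apply/eqmodP; rewrite /= Quotient.equivE; apply/asboolP.
by apply: filterS fg => k /= fg; apply/eqP; rewrite subr_eq0 fg.
Qed.

Lemma ultra_class_surj (x : ultrapower) : exists f, x = ultra_class f.
Proof. by exists (repr x); rewrite /ultra_class reprK. Qed.

(** An ultrafilter contains each set or its complement; this dichotomy turns the quotient ring into
    a field. *)
Lemma ultra_class_neq0 f : ultra_class f != 0 -> U [set k | f k != 0].
Proof.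
move=> f0; case: (in_ultra_setVsetC [set k | f k != 0] UU) => // Uf.
case/eqP: f0; rewrite -(rmorph0 ultra_class); apply/ultra_class_eq.
by apply: filterS Uf => k /= /negP/negPn/eqP.
Qed.

(** For a nonzero class, the coordinates where the convention 0^-1 = 0 applies are negligible. *)
Definition ultra_inv (x : ultrapower) := ultra_class (fun k => (repr x k)^-1).

Let ultra_invE f : ultra_inv (ultra_class f) = ultra_class (fun k => (f k)^-1).
Proof.
apply/ultra_class_eq.
have /ultra_class_eq : ultra_class (repr (ultra_class f)) = ultra_class f.
  by rewrite /ultra_class reprK.
by apply: filterS => k /= ->.
Qed.

Fact ultra_mulVf x : x != 0 -> ultra_inv x * x = 1.
Proof.
case: (ultra_class_surj x) => f -> f0.
rewrite ultra_invE -rmorphM -(rmorph1 ultra_class).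
apply/ultra_class_eq; apply: filterS (ultra_class_neq0 f0) => k /= fk.
by rewrite /GRing.mul /= mulVf.
Qed.

Fact ultra_inv0 : ultra_inv 0 = 0.
Proof.
rewrite -(rmorph0 ultra_class) ultra_invE; apply/ultra_class_eq.
by apply: filterE => k; rewrite /= /0 /= invr0.
Qed.

HB.instance Definition _ :=
  GRing.ComNzRing_isField.Build ultrapower ultra_mulVf ultra_inv0.

Lemma ultra_classV f : (ultra_class f)^-1 = ultra_class (fun k => (f k)^-1).
Proof. exact: ultra_invE. Qed.

End Ultrapower.

(** Representatives of the coefficients give a polynomial [P k] at each coordinate, of full degree
    for almost all k because the leading coefficient of p is nonzero. Roots chosen there assemble
    into a root of p. *)
Lemma ultrapower_closed (T : pointedType) (C : closedFieldType)
    (U : set_system T) (UU : UltraFilter U) (p : {poly ultrapower C UU}) :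
  (1 < size p)%N -> exists x, root p x.
Proof.
move=> p1; pose n := (size p).-1.
pose cls : {rmorphism (T -> C) -> ultrapower C UU} := @ultra_class T C U UU.
pose c i : T -> C := repr p`_i.
pose P k := \poly_(i < n.+1) c i k.
have clsK (x : ultrapower C UU) : cls (repr x) = x.
  by rewrite /= /ultra_class reprK.
have nE : n.+1 = size p by rewrite prednK // (ltn_trans _ p1).
have rootP k : exists x, c n k != 0 -> (P k).[x] = 0.
  (* Where the leading coefficient vanishes any value serves; 0 is a default. *)
  have [ck0|ck0] := eqVneq (c n k) 0; first by exists 0.
  have : size (P k) != 1%N.
    by rewrite size_poly_eq // nE; case: (size p) p1 => [|[]].
  by case/closed_rootP => x /rootP; exists x.
have [g gP] : exists g : T -> C, forall k, c n k != 0 -> (P k).[g k] = 0.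
  by exists (fun k => projT1 (cid (rootP k))) => k; case: cid.
exists (cls g); rewrite /root horner_coef; apply/eqP.
transitivity (cls (\sum_(i < size p) c i * g ^+ i)).
  by rewrite rmorph_sum; apply: eq_bigr => i _; rewrite rmorphM rmorphXn clsK.
rewrite -(rmorph0 cls); apply/ultra_class_eq.
have : cls (c n) != 0.
  by rewrite clsK -lead_coefE lead_coef_eq0 -size_poly_gt0 ltnW.
move/ultra_class_neq0; apply: filterS => k /= /gP gk.
transitivity (P k).[g k]; last exact: gk.
rewrite fct_sumE horner_poly nE; apply: eq_bigr => i _.
rewrite {1}/GRing.mul /=; congr (_ * _).
by elim: (nat_of_ord i) => // m IH; rewrite !exprS -IH.
Qed.

(** * Algebraic extensions *)

(** Bundling the closure proof with the predicate lets the field structure of [subfield_type] be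
    declared as an instance. *)
Record subfield (K : fieldType) := Subfield {
  subfield_pred :> K -> bool;
  subfield_closed : divring_closed subfield_pred
}.

HB.instance Definition _ (K : fieldType) (S : subfield K) :=
  GRing.isDivringClosed.Build K (subfield_pred S) (subfield_closed S).

Record subfield_type (K : fieldType) (S : subfield K) := SubfieldElt {
  subfield_val : K;
  _ : subfield_val \in subfield_pred S
}.

Section SubfieldType.
Variables (K : fieldType) (S : subfield K).

HB.instance Definition _ := [isSub for @subfield_val K S].
HB.instance Definition _ := [Choice of subfield_type S by <:].
HB.instance Definition _ :=
  [SubChoice_isSubIntegralDomain of subfield_type S by <:].
HB.instance Definition _ :=
  [SubIntegralDomain_isSubField of subfield_type S by <:].

End SubfieldType.

Lemma subfield_embedding (K : fieldType) (S : subfield K) :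
  exists (L : fieldType) (e : {rmorphism L -> K}),
    forall x, x \in subfield_pred S <-> exists a, e a = x.
Proof.
exists (subfield_type S), (val : {rmorphism subfield_type S -> K}) => x.
by split=> [xS|[a <-]]; [exists (Sub x xS) | apply: valP].
Qed.

(** Preimages under [e] are chosen pointwise; injectivity of [e] forces the choice to respect the
    operations. *)
Lemma rmorphism_factor (A K E : fieldType) (g : {rmorphism A -> K})
    (e : {rmorphism E -> K}) :
  (forall a, exists x, e x = g a) ->
  exists f : {rmorphism A -> E}, forall a, e (f a) = g a.
Proof.
move=> ge; pose f a := projT1 (cid (ge a)).
have fE a : e (f a) = g a by rewrite /f; case: cid.
have fB : zmod_morphism f.
  by move=> a b; apply: (fmorph_inj e); rewrite rmorphB !fE rmorphB.
have fM : monoid_morphism f.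
  by split=> [|a b]; apply: (fmorph_inj e);
    rewrite ?rmorph1 ?rmorphM !fE ?rmorph1 ?rmorphM.
pose fz := GRing.isZmodMorphism.Build A E f fB.
pose fm := GRing.isMonoidMorphism.Build A E f fM.
pose F : {rmorphism A -> E} := HB.pack f fz fm.
by exists F.
Qed.

(** Strong induction on the degree: a reducible annihilator splits into two factors of smaller
    degree, one of which vanishes at x. *)
Lemma algebraic_irreducible_root (L K : fieldType) (f : {rmorphism L -> K})
    (x : K) :
  algebraicOver f x ->
  exists2 p : {poly L}, irreducible_poly p & root (map_poly f p) x.
Proof.
case=> p p0 px; have [n le_pn] := ubnP (size p).
elim: n => // n IH in p p0 px le_pn *.
have p1 : (1 < size p)%N.
  rewrite ltn_neqAle eq_sym size_poly_gt0 p0 andbT; apply/negP.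
  move=> /size_poly1P[c c0 pc].
  by move: px; rewrite pc map_polyC rootC fmorph_eq0 (negPf c0).
have [irr|] := pselect (irreducible_poly p); first by exists p.
move=> nirr.
have [q [q1 qp qp']] : exists q : {poly L},
    [/\ size q != 1%N, q %| p & ~~ (q %= p)].
  apply: contrapT => noq; apply: nirr; split=> // q q1 qp.
  by apply: contrapT => /negP qp'; apply: noq; exists q.
have [r pE] := dvdpP _ _ qp; have : r * q != 0 by rewrite -pE.
rewrite mulf_eq0 negb_or => /andP[r0 q0].
have ltq : (size q < size p)%N.
  by rewrite ltn_neqAle dvdp_leq // andbT (dvdp_size_eqp qp).
have ltr : (size r < size p)%N.
  rewrite pE size_mul //; have : (1 < size q)%N.
    by rewrite ltn_neqAle eq_sym q1 size_poly_gt0.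
  by case: (size q) => [|[|m]] // _; rewrite !addnS /= ltnS leq_addr.
move: px; rewrite pE rmorphM rootM => /orP[] /IH; apply=> //.
  exact: leq_trans ltr le_pn.
exact: leq_trans ltq le_pn.
Qed.

(** The assignment of q(r) to q(z) is well defined: if q vanishes at z, it is not coprime to the
    irreducible p, so p divides q and q vanishes at r. *)
Lemma hom_extension (L K : fieldType) (F : fieldExtType L)
    (f : {rmorphism L -> K}) (p : {poly L}) (z : F) (r : K) :
    irreducible_poly p -> root (map_poly (in_alg F) p) z ->
    root (map_poly f p) r ->
    (forall x, exists q, x = (map_poly (in_alg F) q).[z]) ->
  exists j : {rmorphism F -> K},
    forall q, j (map_poly (in_alg F) q).[z] = (map_poly f q).[r].
Proof.
move=> irr pz pr gen; pose qq x := projT1 (cid (gen x)).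
have qqE x : x = (map_poly (in_alg F) (qq x)).[z] by rewrite /qq; case: cid.
have zero q : (map_poly (in_alg F) q).[z] = 0 -> (map_poly f q).[r] = 0.
  move=> qz; apply/rootP; apply: (root_dvdp _ pr).
  rewrite dvdp_map; apply: contraT => npq.
  have : coprimep p q by rewrite irreducible_poly_coprime.
  rewrite -(coprimep_map (in_alg F)) => /coprimep_root/(_ pz).
  by rewrite qz eqxx.
have wd q1 q2 : (map_poly (in_alg F) q1).[z] = (map_poly (in_alg F) q2).[z] ->
    (map_poly f q1).[r] = (map_poly f q2).[r].
  move/eqP; rewrite -subr_eq0 -hornerN -hornerD -rmorphB => /eqP/zero/eqP.
  by rewrite rmorphB hornerD hornerN subr_eq0 => /eqP.
pose j x := (map_poly f (qq x)).[r].
have jE q : j (map_poly (in_alg F) q).[z] = (map_poly f q).[r].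
  exact/wd/esym/qqE.
have jB : zmod_morphism j.
  move=> x y; rewrite [x in LHS]qqE [y in LHS]qqE -hornerN -hornerD -rmorphB jE.
  by rewrite rmorphB hornerD hornerN.
have jM : monoid_morphism j.
  split=> [|x y].
    by have := jE 1; rewrite !rmorph1 !hornerC.
  by rewrite [x in LHS]qqE [y in LHS]qqE -hornerM -rmorphM jE rmorphM hornerM.
pose jz := GRing.isZmodMorphism.Build F K j jB.
pose jm := GRing.isMonoidMorphism.Build F K j jM.
pose J : {rmorphism F -> K} := HB.pack j jz jm.
by exists J.
Qed.

(** In characteristic 0 the derivative is nonzero, since its top coefficient is the degree times the
    leading coefficient of p. Being of smaller degree, it is not divisible by p. *)
Lemma irreducible_separable (L : fieldType) (p : {poly L}) :
  [pchar L] =i pred0 -> irreducible_poly p -> separable_poly p.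
Proof.
move=> /pcharf0P char0 irr; rewrite unlock irreducible_poly_coprime //.
have p1 : (1 < size p)%N by case: irr.
have p0 : p != 0 := irredp_neq0 irr.
have [dp0|dp0] := eqVneq p^`() 0; last first.
  by apply/negP => /(dvdp_leq dp0); rewrite leqNgt lt_size_deriv.
move/(congr1 (coefp (size p).-2)): dp0.
rewrite /= coef_deriv coef0 -mulr_natr prednK; last first.
  by case: (size p) p1 => [|[]].
move/eqP; rewrite mulf_eq0 char0 -lead_coefE lead_coef_eq0 (negPf p0) /=.
by case: (size p) p1 => [|[]].
Qed.

Section AlgebraicElements.
Variables (L K : fieldType) (i : {rmorphism L -> K}).

Definition algebraic_elements : pred K := fun x => `[< algebraicOver i x >].

Fact algebraic_elements_closed : divring_closed algebraic_elements.
Proof.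
split=> [|x y|x y].
- exact/asboolP/algebraic1.
- by move=> /asboolP ? /asboolP ?; apply/asboolP/algebraic_sub.
- by move=> /asboolP ? /asboolP ?; apply/asboolP/algebraic_div.
Qed.

End AlgebraicElements.

(** E consists of the elements of K algebraic over L. Separability is automatic in characteristic 0,
    and the roots supplied by K are again algebraic by transitivity. *)
Lemma separable_closure_in (L K : fieldType) (i : {rmorphism L -> K}) :
    [pchar K] =i pred0 ->
    (forall p : {poly K}, (1 < size p)%N -> exists x, root p x) ->
  exists (E : fieldType) (f : {rmorphism L -> E}) (e : {rmorphism E -> K}),
    [/\ separable_closure f, forall a, e (f a) = i a
      & forall x, algebraicOver i x -> exists y, e y = x].
Proof.
move=> char0 closed.
have [E [e eP]] := subfield_embedding (Subfield (algebraic_elements_closed i)).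
have memE x : algebraicOver i x <-> exists y, e y = x.
  by rewrite -eP; split=> /asboolP.
have [f fP] : exists f : {rmorphism L -> E}, forall a, e (f a) = i a.
  by apply: rmorphism_factor => a; apply/memE/algebraic_id.
have map_ef p : map_poly e (map_poly f p) = map_poly i p.
  by rewrite -map_poly_comp; apply: eq_map_poly.
exists E, f, e; split=> [|//|x]; last by move/memE.
have algE x : algebraicOver f x.
  have [|p p0 px] := (memE (e x)).2; first by exists x.
  by exists p => //; move: px; rewrite -map_ef fmorph_root.
split=> [x|p p1 _].
  have [p irr px] := algebraic_irreducible_root (algE x); exists p; split=> //.
  apply: irreducible_separable irr => q.
  by rewrite -(fmorph_pchar i) char0.
have [|x px] := closed (map_poly e p); first by rewrite size_map_poly.
have [|y yx] := (memE x).1.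
  apply/integral_algebraic; apply: (@integral_root _ _ _ (map_poly e p)) px _.
    by rewrite map_poly_eq0 -size_poly_gt0 ltnW.
  move=> c /(nthP 0)[k _ <-]; rewrite coef_map /=.
  by apply/integral_algebraic/memE; exists p`_k.
by exists y; move: px; rewrite -yx fmorph_root.
Qed.

(** * Inertial quadratic extensions *)

Lemma eq_separable_closure (L K : fieldType) (f g : {rmorphism L -> K}) :
  f =1 g -> separable_closure f -> separable_closure g.
Proof.
move=> fg [alg closed]; split=> // x; have [p [irr sep px]] := alg x.
by exists p; split=> //; rewrite -(eq_map_poly fg).
Qed.

(** The map [g] lets the polynomial be evaluated in A while membership is tested in E; below, A is
    O_F and [g] is the conjugate embedding. *)
Lemma mmap_rpred (R A : comNzRingType) (E : nzRingType) (f : {rmorphism R -> A})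
    (g : {rmorphism A -> E}) (S : subringClosed E) n (s : 'I_n -> A) p :
  (forall a, g (f a) \in S) -> (forall i, g (s i) \in S) ->
  g (mpoly.mmap f s p) \in S.
Proof.
move=> fS sS; rewrite /mpoly.mmap rmorph_sum rpred_sum // => m _.
rewrite rmorphM rpredM // /mpoly.mmap1 rmorph_prod rpred_prod // => i _.
by rewrite rmorphXn rpredX.
Qed.

Section QuadraticExtension.
Variables (L E : fieldType) (f : {rmorphism L -> E}) (d : L) (r : E).
Hypotheses (r2 : r ^+ 2 = f d) (rNL : forall a, f a != r).

Lemma quadratic_irreducible : irreducible_poly ('X^2 - d%:P).
Proof.
apply: cubic_irreducible => [|a]; first by rewrite size_XnsubC.
apply/negP; rewrite /root !hornerE subr_eq0 => /eqP a2.
have : f a ^+ 2 == r ^+ 2 by rewrite r2 -a2 rmorphXn.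
rewrite eqf_sqr (negPf (rNL a)) /= => /eqP fa.
by have := rNL (- a); rewrite rmorphN fa opprK eqxx.
Qed.

(** Conjugation is expressed by a second embedding rather than by an automorphism of F: [j] will
    define the valuation, [j'] will give the conjugates. *)
Lemma quadratic_extension :
  exists (F : fieldExtType L) (z : F) (j j' : {rmorphism F -> E}),
    [/\ forall x, exists q, x = (map_poly (in_alg F) q).[z],
        forall a, j (in_alg F a) = f a /\ j' (in_alg F a) = f a
      & j z = r /\ j' z = - r].
Proof.
have irr := quadratic_irreducible.
have [F _ [z pz zgen]] := irredp_FAdjoin irr.
have gen x : exists q, x = (map_poly (in_alg F) q).[z].
  have /Fadjoin_polyP[q /polyOver1P[q' ->] ->] : x \in <<1; z>>%VS.
    by rewrite zgen memvf.
  by exists q'.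
have proot c : c ^+ 2 = f d -> root (map_poly f ('X^2 - d%:P)) c.
  move=> c2; rewrite rmorphB /= map_polyXn map_polyC /root !hornerE /= c2.
  by rewrite subrr.
have [j jE] := hom_extension irr pz (proot r r2) gen.
have [|j' jE'] := hom_extension irr pz (proot (- r) _) gen.
  by rewrite sqrrN.
exists F, z, j, j'; split=> // [a|].
  by have := jE a%:P; have := jE' a%:P; rewrite !map_polyC !hornerC.
by have := jE 'X; have := jE' 'X; rewrite !map_polyX !hornerX.
Qed.

End QuadraticExtension.

(** * A criterion for an inertial quadratic extension without finite generation *)

Section Criterion.
Variables (L E : fieldType) (f : {rmorphism L -> E}).
Variables (G : orderedAbelianGroupType) (w : valuation E G).
Variables (d : L) (r : E) (T : nat -> subringClosed E).
Hypotheses (sepf : separable_closure f).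
Hypotheses (r2 : r ^+ 2 = f d) (rNL : forall a, f a != r).
Hypotheses (wr : r \is a valuation_integer w).
Hypotheses (w2r : r *+ 2 \notin maximal_ideal w).
Hypotheses (TS : forall n, {subset T n <= T n.+1}).
Hypotheses (OT : forall n x, x \is a valuation_integer w -> x \in T n).
Hypotheses (LT : forall a, exists n, f a \in T n).
Hypotheses (approx : forall n, exists a,
  (f a + r)^-1 \is a valuation_integer w /\ (f a - r)^-1 \notin T n).

Let TS_le m n : (m <= n)%N -> {subset T m <= T n}.
Proof.
move=> /subnK <-; elim: (n - m)%N => // k IH x /IH; exact: TS.
Qed.

Let T_common n (s : 'I_n -> E) :
  (forall i, exists m, s i \in T m) -> exists m, forall i, s i \in T m.
Proof.
move=> sT; pose m i := projT1 (cid (sT i)).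
exists (\max_i m i)%N => i; apply: (@TS_le (m i)); first exact: leq_bigmax.
by rewrite /m; case: cid.
Qed.

(** The equation X^2 = d is integral because r is. A general [h] is allowed since the inertia group
    is taken for [j \o in_alg F], which is known to agree with [f] only pointwise. *)
Let r_integral (h : {rmorphism L -> E}) : h d = f d -> integral_closure h w r.
Proof.
move=> hd; have dO : d \is a valuation_integer (restriction h w).
  by have := rpredX 2 wr; rewrite r2 !qualifE /= hd.
have int_r (g : {rmorphism valuation_ring (restriction h w) -> E}) :
    g (ValuationRing dO) = f d -> integralOver g r.
  move=> gd; exists ('X^2 - (ValuationRing dO)%:P); first exact: monicXnsubC.
  by rewrite rmorphB /= map_polyXn map_polyC /root !hornerE /= r2 gd subrr.
exact: (int_r (h \o val)).
Qed.

Lemma inertial_not_finitely_generated :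
  exists (F : fieldExtType L) (v : valuation F G),
    inertial_extension v /\
    ~ finitely_generated_algebra (valuation_ring_incl (in_alg F) v).
Proof.
have [F [z [j [j' [gen jf [jz jz']]]]]] := quadratic_extension r2 rNL.
exists F, (restriction j w); split.
  exists E, j, G, w; split.
  - by apply: eq_separable_closure sepf => a; rewrite /= (jf a).1.
  - by exists idfun; split=> // x; rewrite /restriction /=; case: (w _).
  - move=> x s [[_ sf] sint].
    (* The alternative s r = - r would put 2 r = r - s r in the maximal ideal. *)
    have s_r : s r = r.
      have sr2 : s r ^+ 2 == r ^+ 2.
        by rewrite -rmorphXn r2 -(jf d).1 sf.
      move: sr2; rewrite eqf_sqr => /orP[/eqP //|/eqP srN].
      have [] := sint r (@r_integral (j \o in_alg F) (jf d).1).
      by rewrite srN opprK => w2r'; case/negP: w2r.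
    have [q ->] := gen x; rewrite -!horner_map jz /= s_r -!map_poly_comp.
    by congr _.[_]; apply: eq_map_poly => a; apply: sf.
case=> n [s sgen].
(* x is a polynomial in z whose finitely many coefficients from L share some [T m]; z goes to - r,
   which is integral and so in every [T m]. *)
have jT x : exists n, j' x \in T n.
  have [q ->] := gen x; have [|m qT] := @T_common (size q) (fun i => f q`_i).
    by move=> i; apply: LT.
  exists m; rewrite -horner_map jz' -map_poly_comp horner_coef.
  rewrite size_map_poly rpred_sum // => i _; rewrite coef_map /= (jf _).2.
  by rewrite rpredM ?qT // rpredX ?OT // rpredN.
have [N sN] : exists N, forall i, j' (val (s i)) \in T N.
  by apply: T_common => i; apply: jT.
have [a [aO aT]] := approx N.
(* This element is integral under [j], while [j'] sends it to 1 / (a - r), outside [T N]. *)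
have tO : (in_alg F a + z)^-1 \is a valuation_integer (restriction j w).
  by rewrite qualifE /= fmorphV rmorphD (jf a).1 jz.
have [p pE] := sgen (ValuationRing tO).
case/negP: aT; rewrite -jz' -(jf a).2 -rmorphD -fmorphV.
rewrite -[(_ + z)^-1]/(val (ValuationRing tO)) -pE.
apply: (mmap_rpred (g := j' \o val)) => // b /=.
(* [j] and [j'] agree on L, so coefficients from O_L land among the integers of [w], hence in
   [T N]. *)
rewrite (jf _).2 OT // -(jf _).1.
exact: valP b.
Qed.

End Criterion.

(** * Growth rates in an ultrapower of the complex numbers *)

Lemma sqrtC2_ge1 : 1 <= sqrtC 2 :> algC.
Proof. by rewrite -[leLHS]sqrtC1 ler_sqrtC ?nnegrE ?ler01 ?ler0n // ler1n. Qed.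

(** m is the integer part of s sqrt 2, found as the largest integer with m^2 <= 2 s^2. The crude
    bound 2 s makes the search finite and later keeps the numerators tame. *)
Lemma sqrt2_approx (s : nat) : (0 < s)%N -> exists m : nat,
  (m <= 2 * s)%N /\ `|m%:R / s%:R - sqrtC 2| <= s%:R^-1 :> algC.
Proof.
move=> s0; have P0 : exists m, (m ^ 2 <= 2 * s ^ 2)%N by exists 0.
have Pub m : (m ^ 2 <= 2 * s ^ 2)%N -> (m <= 2 * s)%N.
  move=> ms; rewrite -(leq_exp2r _ _ (isT : (0 < 2)%N)) expnMn.
  by apply: leq_trans ms _; rewrite leq_mul2r orbT.
case: (ex_maxnP P0 Pub) => m ms mmax; exists m; split; first exact: Pub.
have sC : 0 < s%:R :> algC by rewrite ltr0n.
have r0 : 0 <= sqrtC 2 * s%:R :> algC by rewrite mulr_ge0 ?sqrtC_ge0 ?ler0n.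
have r2 : (sqrtC 2 * s%:R) ^+ 2 = (2 * s ^ 2)%N%:R :> algC.
  by rewrite exprMn sqrtCK natrM natrX.
have mr : m%:R <= sqrtC 2 * s%:R :> algC.
  by rewrite -(ler_pXn2r (ltn0Sn 1)) ?nnegrE ?ler0n // r2 -natrX ler_nat.
have rm : sqrtC 2 * s%:R <= m.+1%:R :> algC.
  rewrite -(ler_pXn2r (ltn0Sn 1)) ?nnegrE ?ler0n // r2 -natrX ler_nat ltnW //.
  by rewrite ltnNge; apply/negP => /mmax; rewrite ltnn.
have -> : m%:R / s%:R - sqrtC 2 = (m%:R - sqrtC 2 * s%:R) / s%:R :> algC.
  by rewrite mulrBl mulfK // gt_eqF.
rewrite normrM normfV (ger0_norm (ltW sC)) distrC ger0_norm ?subr_ge0 //.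
by rewrite ler_piMl ?invr_ge0 ?ler0n // lerBlDl natr1.
Qed.

(** The values of x and x^-1 are opposite, so an integral inverse forces v x <= 0. *)
Lemma maximal_ideal_inv (F : fieldType) (G : orderedAbelianGroupType)
    (v : valuation F G) x :
  x != 0 -> x^-1 \is a valuation_integer v -> x \notin maximal_ideal v.
Proof.
move=> x0; rewrite qualifE /= inE /vlt negbK.
have := valuationM v x x^-1; rewrite mulfV // valuation1.
case: (v x) => [g|] //; case: (v x^-1) => [h|] //= [gh] h0.
by have := oag_leD2r g _ _ h0; rewrite add0r addrC -gh.
Qed.

(** The exponent of 2 is even in p^2 and odd in 2 q^2. *)
Lemma sqrt2_irrational (p q : int) :
  q != 0 -> p%:~R / q%:~R != sqrtC 2 :> algC.
Proof.
move=> q0; apply/negP => /eqP pq.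
have qC0 : q%:~R != 0 :> algC by rewrite intr_eq0.
have : p ^+ 2 = 2 * q ^+ 2.
  apply: (@intr_inj algC); rewrite rmorphXn rmorphM rmorphXn /=.
  by rewrite -[p%:~R](divfK qC0) pq exprMn sqrtCK.
move/(congr1 absz); rewrite abszM !abszX /= => e.
have q0' : (0 < `|q|)%N by rewrite absz_gt0.
have p0' : (0 < `|p|)%N.
  by have := expn_gt0 `|p| 2; rewrite e muln_gt0 expn_gt0 q0' /= orbF => <-.
move/(congr1 (logn 2))/(congr1 odd): e.
by rewrite lognM ?expn_gt0 ?q0' // !lognX !mul2n oddD !odd_double.
Qed.

(* The double exponential makes [scale n.+1 k] equal to [scale n k ^ k.+2],
   which outgrows every fixed power of [scale n k] as k varies. *)
Definition scale n k := (k.+2 ^ (k.+2 ^ n))%N.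

Lemma scale_gt1 n k : (1 < scale n k)%N.
Proof. by rewrite /scale -(exp1n (k.+2 ^ n)) ltn_exp2r ?expn_gt0. Qed.

Lemma scaleS n k : scale n.+1 k = (scale n k ^ k.+2)%N.
Proof. by rewrite /scale expnSr expnM. Qed.

Lemma leq_scale m n k : (m <= n)%N -> (scale m k <= scale n k)%N.
Proof. by move=> mn; rewrite leq_pexp2l // leq_pexp2l. Qed.

(** The sizes allowed for numerators and denominators of elements of L. *)
Definition tame (u : nat -> nat) := exists n, forall k, (u k <= scale n k)%N.

Lemma tame_le u v : (forall k, u k <= v k)%N -> tame v -> tame u.
Proof. by move=> uv [n vn]; exists n => k; apply: leq_trans (vn k). Qed.

(** One step up the scale absorbs a product, and also a sum; this makes the tame rationals a
    field. *)
Lemma scale_sqr n k : (scale n k * scale n k <= scale n.+1 k)%N.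
Proof. by rewrite scaleS mulnn leq_pexp2l // ltnW ?scale_gt1. Qed.

Lemma tame_pair u v : tame u -> tame v ->
  exists n, forall k, (u k <= scale n k)%N /\ (v k <= scale n k)%N.
Proof.
move=> [m um] [n vn]; exists (maxn m n) => k.
split; [apply: leq_trans (um k) _ | apply: leq_trans (vn k) _];
  by rewrite leq_scale ?leq_maxl ?leq_maxr.
Qed.

Lemma tame_mul u v : tame u -> tame v -> tame (fun k => u k * v k)%N.
Proof.
move=> tu /(tame_pair tu)[n uvn]; exists n.+1 => k; have [un vn] := uvn k.
exact: leq_trans (leq_mul un vn) (scale_sqr n k).
Qed.

Lemma tame_add u v : tame u -> tame v -> tame (fun k => u k + v k)%N.
Proof.
move=> tu /(tame_pair tu)[n uvn]; exists n.+1 => k; have [un vn] := uvn k.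
apply: leq_trans (leq_add un vn) (leq_trans _ (scale_sqr n k)).
by rewrite addnn -muln2 leq_mul2l scale_gt1 orbT.
Qed.

Lemma tame_cst c : tame (fun=> c).
Proof.
(* The constant is its own index: c < (k+2)^c < (k+2)^((k+2)^c). *)
exists c => k; apply: ltnW; apply: leq_trans (ltn_expl c _) _; last first.
  by apply: ltnW; apply: ltn_expl.
by [].
Qed.

(** * Rings of bounded growth and the field of tame rationals *)

Section TameRationals.
Variables (U : set_system nat) (UU : UltraFilter U).
Hypothesis Uoo : forall n, U [set k | (n <= k)%N].

Let K := ultrapower algC UU.
Let cls : {rmorphism (nat -> algC) -> K} := @ultra_class _ algC U UU.

(** The exponent N is uniform in k. The constant b = 2 gives the bounded elements, the valuation
    ring of K; b = [scale n] gives the ring T_n. *)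
Definition growth (b : nat -> nat) : pred K := fun x =>
  `[< exists f, x = cls f /\ exists N, U [set k | `|f k| <= (b k)%:R ^+ N] >].

Lemma growthE b f :
  growth b (cls f) <-> exists N, U [set k | `|f k| <= (b k)%:R ^+ N].
Proof.
split=> [/asboolP[g [/ultra_class_eq fg [N gN]]]|fN]; last first.
  by apply/asboolP; exists f.
by exists N; apply: filterS2 fg gN => k /= ->.
Qed.

Lemma growth_closed b : (forall k, (1 < b k)%N) -> subring_closed (growth b).
Proof.
move=> b1; have bX (k N : nat) : 1 <= (b k)%:R ^+ N :> algC.
  by rewrite exprn_ege1 // ler1n ltnW.
split=> [|x y|x y].
- rewrite -(rmorph1 cls); apply/growthE; exists 0.
  by apply: filterE => k; rewrite /= normr1.
- have [f ->] := ultra_class_surj x; have [g ->] := ultra_class_surj y.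
  move=> /growthE[N fN] /growthE[M gM]; rewrite -rmorphB; apply/growthE.
  (* b^N + b^M <= 2 b^(N+M) <= b^(N+M+1), as b >= 2. *)
  exists (N + M).+1; apply: filterS2 fN gM => k /= fN gM.
  apply: le_trans (ler_normB _ _) (le_trans (lerD fN gM) _).
  apply: (@le_trans _ _ ((b k)%:R ^+ (N + M) *+ 2)).
    rewrite mulr2n exprD lerD ?ler_peMr ?ler_peMl // ?exprn_ge0 //.
  by rewrite -mulr_natl exprS ler_wpM2r ?exprn_ge0 // ler_nat.
- have [f ->] := ultra_class_surj x; have [g ->] := ultra_class_surj y.
  move=> /growthE[N fN] /growthE[M gM]; rewrite -rmorphM; apply/growthE.
  exists (N + M)%N; apply: filterS2 fN gM => k /= fN gM.
  by rewrite normrM exprD ler_pM.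
Qed.

(** On a set of U either |f| <= 1 throughout or |f| > 1 throughout; the exponent 0 then bounds f or
    its inverse. *)
Lemma growth_total b x : growth b x \/ growth b x^-1.
Proof.
have [f ->] := ultra_class_surj x; rewrite ultra_classV.
have [fU|fU] := in_ultra_setVsetC [set k | `|f k| <= 1] UU; [left|right];
  apply/growthE; exists 0; apply: filterS fU => k //= /negP.
rewrite -real_ltNge ?normr_real // => f1.
by rewrite normfV expr0 invf_le1 ?(lt_trans ltr01) ?ltW.
Qed.

Lemma growth_le b c : (forall k, b k <= c k)%N -> {subset growth b <= growth c}.
Proof.
move=> bc x; have [f ->] := ultra_class_surj x => /growthE[N fN].
apply/growthE; exists N; apply: filterS fN => k /= fN.
by apply: le_trans fN _; rewrite lerXn2r ?nnegrE ?ler0n ?ler_nat.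
Qed.

Definition fraction_class (p q : nat -> int) : K :=
  cls (fun k => (p k)%:~R / (q k)%:~R).

Definition tame_rational : pred K := fun x => `[< exists p q,
  [/\ x = fraction_class p q, forall k, q k != 0,
      tame (fun k => `|p k|%N) & tame (fun k => `|q k|%N)] >].

Lemma tame_rational_closed : divring_closed tame_rational.
Proof.
have T1 : tame_rational 1.
  apply/asboolP; exists (fun=> 1), (fun=> 1); split=> //; try exact: tame_cst.
  rewrite -(rmorph1 cls); apply/ultra_class_eq.
  by apply: filterE => k; rewrite /= divr1.
have TB : {in tame_rational &, forall x y, x - y \in tame_rational}.
  move=> x y /asboolP[p [q [-> q0 tp tq]]] /asboolP[p' [q' [-> q'0 tp' tq']]].
  apply/asboolP; exists (fun k => p k * q' k - p' k * q k).
  exists (fun k => q k * q' k).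
  split=> [|k||].
  - rewrite -rmorphB; apply/ultra_class_eq; apply: filterE => k /=.
    transitivity ((p k)%:~R / (q k)%:~R - (p' k)%:~R / (q' k)%:~R : algC) => //.
    rewrite -mulNr addf_div ?intr_eq0 //.
    by rewrite rmorphB !rmorphM mulNr.
  - by rewrite mulf_neq0.
  - apply: tame_le (tame_add (tame_mul tp tq') (tame_mul tp' tq)) => k.
    by rewrite -!abszM -lez_nat PoszD !abszE ler_normB.
  - by apply: tame_le (tame_mul tq tq') => k; rewrite abszM.
split=> // x y /asboolP[p [q [-> q0 tp tq]]] /asboolP[p' [q' [-> q'0 tp' tq']]].
(* Division by 0 yields 0, which is tame as 1 - 1. *)
have [p'0|p'0] := eqVneq (fraction_class p' q') 0.
  by rewrite p'0 invr0 mulr0 -(subrr 1) TB.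
apply/asboolP; exists (fun k => p k * q' k).
(* A nonzero class may still have zero coordinates; replacing them by 1 keeps every denominator
   nonzero and changes the fraction only outside a set of U. *)
exists (fun k => q k * (if p' k == 0 then 1 else p' k)).
split=> [|k||].
- rewrite /fraction_class ultra_classV -rmorphM; apply/ultra_class_eq.
  apply: filterS (ultra_class_neq0 p'0) => k /=.
  rewrite mulf_eq0 invr_eq0 !intr_eq0 negb_or => /andP[/negPf -> _].
  transitivity ((p k)%:~R / (q k)%:~R / ((p' k)%:~R / (q' k)%:~R) : algC) => //.
  by rewrite !rmorphM invf_div mulf_div.
- by rewrite mulf_neq0 //; case: (eqVneq (p' k) 0).
- by apply: tame_le (tame_mul tp tq') => k; rewrite abszM.
- apply: tame_le (tame_mul tq (tame_add (tame_cst 1) tp')) => k; rewrite abszM.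
  by rewrite leq_mul2l; case: (eqVneq (p' k) 0) => _;
    rewrite ?leq_addl ?leq_addr orbT.
Qed.

(** A nonzero integer denominator has absolute value at least 1, so the numerator alone bounds the
    fraction. *)
Lemma tame_rational_growth x : tame_rational x -> exists n, growth (scale n) x.
Proof.
move=> /asboolP[p [q [-> q0 [n pn] _]]]; exists n; apply/growthE; exists 1.
apply: filterE => k /=; rewrite expr1 normrM normfV.
rewrite ler_pdivrMr ?normr_gt0 ?intr_eq0 //.
rewrite -!intr_norm -!natr_absz -natrM ler_nat.
by apply: leq_trans (pn k) _; rewrite leq_pmulr // absz_gt0.
Qed.

Definition ultra_sqrt2 : K := cls (fun=> sqrtC 2).

Lemma sqrt2_sqr : ultra_sqrt2 ^+ 2 = 2.
Proof.
rewrite /ultra_sqrt2 -rmorphXn -(rmorph_nat cls 2); apply/ultra_class_eq.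
by apply: filterE => k; apply: (sqrtCK 2).
Qed.

Lemma sqrt2_notin x : tame_rational x -> x != ultra_sqrt2.
Proof.
move=> /asboolP[p [q [-> q0 _ _]]]; apply/negP => /eqP/ultra_class_eq.
by move=> /(@filter_ex _ _ _)[k] /eqP; apply/negP/sqrt2_irrational.
Qed.

Lemma sqrt2_bounded : growth (fun=> 2%N) ultra_sqrt2.
Proof.
apply/growthE; exists 1; apply: filterE => k /=.
rewrite ger0_norm ?sqrtC_ge0 ?ler0n // -(ler_pXn2r (ltn0Sn 1)) ?nnegrE;
  rewrite ?sqrtC_ge0 ?ler0n //.
by rewrite sqrtCK expr1 -natrX ler_nat.
Qed.

Lemma sqrt2_double_inv_bounded : growth (fun=> 2%N) (ultra_sqrt2 *+ 2)^-1.
Proof.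
rewrite -rmorphMn ultra_classV; apply/growthE; exists 0; apply: filterE => k /=.
have h : 1 <= `|sqrtC 2 *+ 2| :> algC.
  rewrite ger0_norm ?mulrn_wge0 ?sqrtC_ge0 ?ler0n //.
  by rewrite mulr2n ler_wpDr ?sqrtC_ge0 ?ler0n // sqrtC2_ge1.
by rewrite normfV expr0 invf_le1 // (lt_le_trans ltr01 h).
Qed.

Lemma tame_rational_approx n : exists2 x, tame_rational x &
  growth (fun=> 2%N) (x + ultra_sqrt2)^-1 /\
  ~ growth (scale n) (x - ultra_sqrt2)^-1.
Proof.
(* With denominators one level above n, the error 1 / s is smaller than the inverse of any fixed
   power of [scale n]. *)
pose s := scale n.+1.
have s0 k : (0 < s k)%N by rewrite ltnW ?scale_gt1.
pose m k := projT1 (cid (sqrt2_approx (s0 k))).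
have mP k : (m k <= 2 * s k)%N /\
    `|(m k)%:R / (s k)%:R - sqrtC 2| <= (s k)%:R^-1 :> algC.
  by rewrite /m; case: cid.
have ts : tame s by exists n.+1.
exists (fraction_class (fun k => (m k)%:Z) (fun k => (s k)%:Z)).
  apply/asboolP; do 2!eexists; split; first by []; rewrite //.
  - by move=> k; rewrite -lt0n.
  - by apply: tame_le (tame_mul (tame_cst 2) ts) => k; case: (mP k).
have r1 := sqrtC2_ge1.
split.
  rewrite -rmorphD ultra_classV; apply/growthE; exists 0.
  apply: filterE => k /=.
  have h : 1 <= `|(m k)%:R / (s k)%:R + sqrtC 2| :> algC.
    by rewrite ger0_norm ?addr_ge0 ?(le_trans ler01 r1) ?ler_wpDl
       ?divr_ge0 ?ler0n.
  by rewrite normfV expr0 invf_le1 // (lt_le_trans ltr01 h).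
rewrite -rmorphB ultra_classV => /growthE[N].
(* At a coordinate k >= N the supposed bound fails: the inverse has absolute value at least s k =
   (scale n k)^(k+2) > (scale n k)^N. *)
move=> /(filterI (Uoo N)) /(@filter_ex _ _ _)[k [/= Nk]].
apply/negP; rewrite -real_ltNge ?ger0_real ?exprn_ge0 ?ler0n // normfV.
have [_ ms] := mP k; apply: (@lt_le_trans _ _ (s k)%:R).
  rewrite -natrX ltr_nat /s scaleS ltn_exp2l ?scale_gt1 //.
  by rewrite ltnS (leq_trans Nk).
(* The error may be inverted because it is nonzero, by irrationality of sqrt 2. *)
rewrite -[leLHS]invrK lef_pV2 ?posrE ?invr_gt0 ?ltr0n // normr_gt0 subr_eq0.
by apply: (sqrt2_irrational (m k)); rewrite -lt0n.
Qed.

End TameRationals.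

Arguments growth {U} UU b x.
Arguments tame_rational {U} UU x.
Arguments growth_total {U} UU b x.

(** * The extension of the tame rationals by sqrt 2 *)

Theorem theorem1p5 :
  exists (L : fieldType) (F : fieldExtType L) (G : orderedAbelianGroupType)
         (v : valuation F G),
    inertial_extension v /\
    ~ finitely_generated_algebra (valuation_ring_incl (in_alg F) v).
Proof.
(* Refining the filter of cofinite sets makes U nonprincipal, so the sequences in [scale] become
   infinite integers. *)
have [U [UU Uoo]] := ultraFilterLemma eventually_filter.
have {}Uoo n : U [set k | (n <= k)%N] by apply: Uoo; exists n.
pose K := ultrapower algC UU.
pose cls : {rmorphism (nat -> algC) -> K} := @ultra_class _ algC U UU.
have char0 : [pchar K] =i pred0.
  apply/pcharf0P => n; apply/idP/idP => [/eqP|/eqP -> //].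
  rewrite -(rmorph_nat cls) -(rmorph0 cls).
  move=> /ultra_class_eq/(@filter_ex _ _ _)[k] /=.
  have -> : (n%:R : nat -> algC) k = n%:R.
    by elim: n => // n IH; rewrite !mulrS -IH.
  by move/eqP; rewrite pnatr_eq0.
have [L [i iP]] := subfield_embedding (Subfield (tame_rational_closed UU)).
have [E [f [e [sepf ef algE]]]] :=
  separable_closure_in i char0 (@ultrapower_closed _ _ _ UU).
have s2 := sqrt2_sqr UU.
have [r er] : exists r, e r = ultra_sqrt2 UU.
  apply: algE; apply/integral_algebraic; exists ('X^2 - 2%:P).
    exact: monicXnsubC.
  rewrite rmorphB /= map_polyXn map_polyC /root !hornerE /= s2.
  by rewrite rmorph_nat subrr.
have c2 (k : nat) : (1 < 2)%N by [].
pose O := ValuationSubring (growth_closed UU c2) (growth_total UU (fun=> 2%N)).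
(* E is the algebraic closure of L inside K, so the size valuation of K restricts to it. *)
pose w := restriction e (subring_valuation O).
have wE x : (x \is a valuation_integer w) = (e x \in growth UU (fun=> 2%N)).
  by rewrite -[RHS](subring_valuation_integer O) !qualifE.
pose Tpred n : pred E := [pred x | e x \in growth UU (scale n)].
have Tclosed n : subring_closed (Tpred n).
  have [T1 TB TM] := growth_closed UU (scale_gt1 n).
  split=> [|x y xT yT|x y xT yT].
  - by move: T1; rewrite -(rmorph1 e).
  - by have := TB _ _ xT yT; rewrite -rmorphB.
  - by have := TM _ _ xT yT; rewrite -rmorphM.
pose Tmix n := GRing.isSubringClosed.Build E (Tpred n) (Tclosed n).
pose T n : subringClosed E := HB.pack (Tpred n) (Tmix n).
exists L; suff [F [v Fv]] : exists (F : fieldExtType L)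
      (v : valuation F (value_group O)),
    inertial_extension v /\
    ~ finitely_generated_algebra (valuation_ring_incl (in_alg F) v).
  by exists F, (value_group O), v.
have i_mem a : tame_rational UU (i a) by apply/iP; exists a.
apply: (@inertial_not_finitely_generated L E f _ w 2 r T) => //.
- by apply: (fmorph_inj e); rewrite rmorphXn er s2 !rmorph_nat.
- move=> a; apply/negP => /eqP fa; have := sqrt2_notin (i_mem a).
  by rewrite -ef fa er eqxx.
- by rewrite wE er; apply: sqrt2_bounded.
(* 2 sqrt 2 has a bounded inverse, so it is not infinitesimal; [two0] ensures that it is nonzero. *)
- apply: maximal_ideal_inv.
    have two0 : 2 != 0 :> E.
      by rewrite -(fmorph_eq0 e) rmorph_nat ((pcharf0P _).1 char0).
    rewrite -mulr_natr mulf_neq0 //; apply: contraNneq two0 => r0.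
    by rewrite -(fmorph_eq0 e) rmorph_nat -s2 -er r0 rmorph0 expr0n.
  by rewrite wE fmorphV rmorphMn er; apply: sqrt2_double_inv_bounded.
- move=> n x; apply: growth_le => k; apply: leq_scale; exact: leqnSn.
- move=> n x; rewrite wE; apply: growth_le => k; exact: scale_gt1.
- move=> a; have [n na] := tame_rational_growth (i_mem a); exists n.
  by rewrite -ef in na.
- move=> n; have [x /iP[a <-] [h1 h2]] := tame_rational_approx UU Uoo n.
  exists a; split; first by rewrite wE fmorphV rmorphD ef er.
  by apply/negP; rewrite -topredE /= /Tpred /= fmorphV rmorphB ef er => /h2.
Qed.
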